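(* Let $\mathscr{A}=(a_{ijkl})\in\mathbb{T}_{4,3}$ be a paired symmetric tensor (in particular, possibly an elasticity tensor). Then the following are equivalent: (i) the polynomial $\mathscr{A}x^2y^2$ is positive definite; (ii) the matrix $A(y)$ is positive definite for all $y\in\mathbb{R}^3\setminus\{0\}$; (iii) the matrix $B(x)$ is positive definite for all $x\in\mathbb{R}^3\setminus\{0\}$.
   Context: $\mathbb{T}_{4,3}$ is the set of real tensors $\mathscr{A}=(a_{ijkl})$ with $i,j,k,l\in\{1,2,3\}$. $\mathscr{A}$ is paired symmetric if $a_{ijkl}=a_{jikl}=a_{ijlk}=a_{jilk}$ for all indices; it is an elasticity tensor if moreover $a_{ijkl}=a_{klij}$ for all indices. For $x,y\in\mathbb{R}^3$, $\mathscr{A}x^2y^2:=\sum_{i,j,k,l=1}^3a_{ijkl}x_ix_jy_ky_l$; this polynomial is positive definite if $\mathscr{A}x^2y^2>0$ for all $x,y\in\mathbb{R}^3\setminus\{0\}$. For $i,j\in\{1,2,3\}$, $A_{ij}\in\mathbb{R}^{3\times3}$ is the matrix whose $(k,l)$ entry is $a_{ijkl}$; for $k,l\in\{1,2,3\}$, $B_{kl}\in\mathbb{R}^{3\times 3}$ is the matrix whose $(i,j)$ entry is $a_{ijkl}$. For $x,y\in\mathbb{R}^3$, $A(y)\in\mathbb{R}^{3\times3}$ has $(i,j)$ entry $y^\top A_{ij}y$, and $B(x)\in\mathbb{R}^{3\times 3}$ has $(k,l)$ entry $x^\top B_{kl}x$. *)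

(* Defs.v *)
From mathcomp Require Import all_boot all_order all_algebra.
From mathcomp Require Import reals.

Set Implicit Arguments.
Unset Strict Implicit.
Unset Printing Implicit Defensive.

Import Order.TTheory GRing.Theory Num.Theory.
Local Open Scope ring_scope.

Definition tensor43 (R : realType) : Type :=
  'I_3 -> 'I_3 -> 'I_3 -> 'I_3 -> R.

Definition paired_symmetric (R : realType) (a : tensor43 R) : Prop :=
  forall i j k l : 'I_3,
    [/\ a i j k l = a j i k l, a i j k l = a i j l k & a i j k l = a j i l k].

Definition biquadratic (R : realType) (a : tensor43 R) (x y : 'cV[R]_3) : R :=
  \sum_(i < 3) \sum_(j < 3) \sum_(k < 3) \sum_(l < 3)
    a i j k l * x i 0 * x j 0 * y k 0 * y l 0.

Definition biquadratic_posdef (R : realType) (a : tensor43 R) : Prop :=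
  forall x y : 'cV[R]_3, x != 0 -> y != 0 -> 0 < biquadratic a x y.

(* The product [x^T *m M *m x] is a 1 x 1 matrix. *)
Definition qform (R : realType) (n : nat) (M : 'M[R]_n) (x : 'cV[R]_n) : R :=
  (x^T *m M *m x) 0 0.

(* Positive definite matrices are symmetric by convention. *)
Definition posdefmx (R : realType) (n : nat) (M : 'M[R]_n) : Prop :=
  M^T = M /\ forall x : 'cV[R]_n, x != 0 -> 0 < qform M x.

Definition sliceA (R : realType) (a : tensor43 R) (i j : 'I_3) : 'M[R]_3 :=
  \matrix_(k < 3, l < 3) a i j k l.

Definition sliceB (R : realType) (a : tensor43 R) (k l : 'I_3) : 'M[R]_3 :=
  \matrix_(i < 3, j < 3) a i j k l.

Definition matA (R : realType) (a : tensor43 R) (y : 'cV[R]_3) : 'M[R]_3 :=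
  \matrix_(i < 3, j < 3) qform (sliceA a i j) y.

Definition matB (R : realType) (a : tensor43 R) (x : 'cV[R]_3) : 'M[R]_3 :=
  \matrix_(k < 3, l < 3) qform (sliceB a k l) x.

(* Main.v *)
Require Import Defs.
From mathcomp Require Import all_boot all_order all_algebra.
From mathcomp Require Import reals.

Import Order.TTheory GRing.Theory Num.Theory.
Local Open Scope ring_scope.

(** For fixed [y] the biquadratic form is the quadratic form of [matA a y] in [x], and for fixed [x]
    it is that of [matB a x] in [y] ([qform_matA], [qform_matB]). Positivity for all nonzero pairs
    is thus positivity of either family of quadratic forms. Paired symmetry makes the matrices
    themselves symmetric ([matA_sym], [matB_sym]), as [posdefmx] demands. *)

Lemma qformE (R : realType) (n : nat) (M : 'M[R]_n) (x : 'cV[R]_n) :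
  qform M x = \sum_i \sum_j M i j * x i 0 * x j 0.
Proof.
rewrite /qform mxE exchange_big; apply: eq_bigr => j _.
rewrite mxE mulr_suml; apply: eq_bigr => i _.
by rewrite mxE (mulrC (x i 0)).
Qed.

Lemma qform_matA (R : realType) (a : tensor43 R) (x y : 'cV[R]_3) :
  qform (matA a y) x = biquadratic a x y.
Proof.
rewrite qformE; apply: eq_bigr => i _; apply: eq_bigr => j _.
rewrite mxE qformE !mulr_suml; apply: eq_bigr => k _.
rewrite !mulr_suml; apply: eq_bigr => l _.
by rewrite mxE -!mulrA; congr (_ * _); rewrite mulrA mulrC -mulrA.
Qed.

Lemma qform_matB (R : realType) (a : tensor43 R) (x y : 'cV[R]_3) :
  qform (matB a x) y = biquadratic a x y.
Proof.
transitivity (\sum_k \sum_l \sum_i \sum_j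
    a i j k l * x i 0 * x j 0 * y k 0 * y l 0).
  rewrite qformE; apply: eq_bigr => k _; apply: eq_bigr => l _.
  rewrite mxE qformE !mulr_suml; apply: eq_bigr => i _.
  by rewrite !mulr_suml; apply: eq_bigr => j _; rewrite mxE.
(* The summation order is [k, l, i, j]. Adjacent swaps carry [i] to the front, then [j] past [l] and
   [k], giving [i, j, k, l]. *)
under eq_bigr => k _ do rewrite exchange_big.
rewrite exchange_big; apply: eq_bigr => i _.
under eq_bigr => k _ do rewrite exchange_big.
by rewrite exchange_big.
Qed.

(** Swapping the first two indices of [a] turns [sliceA a j i] into [sliceA a i j]. *)
Lemma matA_sym (R : realType) (a : tensor43 R) (y : 'cV[R]_3) :
  paired_symmetric a -> (matA a y)^T = matA a y.
Proof.
move=> ha; apply/matrixP => i j; rewrite !mxE; congr (qform _ y).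
by apply/matrixP => k l; rewrite !mxE; case: (ha j i k l).
Qed.

(** Here the swap of the last two indices identifies [sliceB a l k] with [sliceB a k l]. *)
Lemma matB_sym (R : realType) (a : tensor43 R) (x : 'cV[R]_3) :
  paired_symmetric a -> (matB a x)^T = matB a x.
Proof.
move=> ha; apply/matrixP => k l; rewrite !mxE; congr (qform _ x).
by apply/matrixP => i j; rewrite !mxE; case: (ha i j l k).
Qed.

Theorem proposition4p1 (R : realType) (a : tensor43 R)
    (ha : paired_symmetric a) :
  (biquadratic_posdef a <->
     (forall y : 'cV[R]_3, y != 0 -> posdefmx (matA a y))) /\
  (biquadratic_posdef a <->
     (forall x : 'cV[R]_3, x != 0 -> posdefmx (matB a x))).
Proof.
split; split.
- move=> apos y y0; split=> [|x x0]; first exact: matA_sym.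
  by rewrite qform_matA; apply: apos.
- by move=> Apos x y x0 /Apos[_ /(_ x x0)]; rewrite qform_matA.
- move=> apos x x0; split=> [|y y0]; first exact: matB_sym.
  by rewrite qform_matB; apply: apos.
- by move=> Bpos x y /Bpos[_ Bx] /Bx; rewrite qform_matB.
Qed.
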